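(* For every $n\ge 1$ there is a bijection $\phi^{(B)}_V:\mathcal{VS}^{(B)}_n\to\mathcal{T}^\circ_n$ which, for each $1\le k\le n$, restricts to a bijection from $\mathcal{VS}^{(B)}_{n,k}$ onto $\mathcal{T}^\circ_{n,k}$.
   Context: Signed permutations in window notation $\sigma=\sigma_1\cdots\sigma_n$ (entries in $\{\pm1,\dots,\pm n\}$, absolute values a permutation of $[n]$), $|\sigma|=|\sigma_1|\cdots|\sigma_n|$. Position $i$ of a sequence $w$ of distinct positive integers is a valley if $2\le i\le n-1$ and $w_{i-1}>w_i<w_{i+1}$, or $i=1$ and $w_1<w_2$. $\mathcal{VS}^{(B)}_n$: signed permutations such that whenever $\sigma_i<0$, $i\ge 2$ and $|\sigma_{i-1}|$ is a valley of $|\sigma|$; $\mathcal{VS}^{(B)}_{n,k}$: those with $\sigma_1=k$. $\mathcal{T}_n$: complete increasing binary trees with $n$ labelled nodes — plane rooted trees in which every node is a leaf or has two ordered children (left, right), exactly $n$ nodes labelled bijectively by $[n]$, all non-leaf nodes labelled (leaves may be labelled or empty), labels increasing along paths from the root. Rightmost path $(v_1,\dots,v_d)$: $v_1$ the root, $v_{i+1}$ the right child of $v_i$, $v_d$ a leaf. $\mathcal{T}^\circ_n$: trees with $v_d$ empty; the rightmost label of such a tree is the label of $v_{d-1}$. $\mathcal{T}^\circ_{n,k}$: those with rightmost label $k$. *)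

(* Defs.v *)
From mathcomp Require Import all_boot all_order all_algebra.
From mathcomp Require Import boolp classical_sets functions.

Import Order.TTheory GRing.Theory Num.Theory.
Local Open Scope classical_set_scope.

(* Windows are indexed from 1: [entry x0 w i] is w_i for 1 <= i <= size w. *)
Definition entry {T : Type} (x0 : T) (w : seq T) (i : nat) : T :=
  nth x0 w i.-1.

Definition valley (w : seq nat) (i : nat) : Prop :=
  [/\ 2 <= i, i <= (size w).-1, entry 0 w i < entry 0 w i.-1
    & entry 0 w i < entry 0 w i.+1]
  \/ [/\ i = 1, 2 <= size w & entry 0 w 1 < entry 0 w 2].

Definition abs_window (s : seq int) : seq nat := [seq `|x|%N | x : int <- s].

(* The entries are then automatically in {1, -1, ..., n, -n}. *)
Definition signed_perm (n : nat) : set (n.-tuple int) :=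
  [set s | perm_eq (abs_window s) (iota 1 n)].

Definition VSB (n : nat) : set (n.-tuple int) :=
  [set s | signed_perm n s /\
    forall i, 1 <= i <= n -> (entry 0 s i < 0)%R ->
      2 <= i /\ valley (abs_window s) i.-1].

Definition VSBk (n k : nat) : set (n.-tuple int) :=
  [set s | VSB n s /\ entry 0%R s 1 = Posz k].

(* [Leaf None] is an empty leaf. *)
Inductive tree : Type :=
| Leaf (label : option nat)
| Node (label : nat) (left right : tree).

Fixpoint labels (t : tree) : seq nat :=
  match t with
  | Leaf None => [::]
  | Leaf (Some x) => [:: x]
  | Node x l r => x :: labels l ++ labels r
  end.

Fixpoint increasing (t : tree) : bool :=
  match t with
  | Leaf _ => true
  | Node x l r =>
      [&& all (ltn x) (labels l), all (ltn x) (labels r),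
          increasing l & increasing r]
  end.

Definition CIBT (n : nat) : set tree :=
  [set t | perm_eq (labels t) (iota 1 n) /\ increasing t].

(* The labels of v_1, ..., v_d, with [None] for an empty leaf. *)
Fixpoint rightmost_path (t : tree) : seq (option nat) :=
  match t with
  | Leaf o => [:: o]
  | Node x _ r => Some x :: rightmost_path r
  end.

Definition Tcirc (n : nat) : set tree :=
  [set t | CIBT n t /\ last None (rightmost_path t) = None].

(* The label of v_{d-1}; meaningful when d >= 2, which holds on [Tcirc n]
   as soon as n >= 1. *)
Definition rightmost_label (t : tree) : option nat :=
  nth None (rightmost_path t) (size (rightmost_path t)).-2.

Definition Tcirck (n k : nat) : set tree :=
  [set t | Tcirc n t /\ rightmost_label t = Some k].

(* Main.v *)
Require Import Defs.
From mathcomp Require Import all_boot all_order all_algebra.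
From mathcomp Require Import boolp classical_sets functions.
From mathcomp Require Import zify.

Import Order.TTheory GRing.Theory Num.Theory.

Set Implicit Arguments.
Unset Strict Implicit.
Unset Printing Implicit Defensive.

(** Cut a window at its entry [m] of least absolute value, [s = a ++ m :: b].
    The entry [m] is a valley unless it is last (position 1 counting as a
    descent), and apart from the signs allowed just after [m], the
    conditions on [a] and [b] are independent.  On the tree side, [m] is the
    root, [a] becomes the right subtree (so the first entry of [s] is the
    rightmost label) and [b] the left one.  The block [b] is preceded by a valley
    smaller than all of it: its first sign is free and its first position is not
    a valley.  These "free" words correspond to all increasing trees.  For a
    free word [m :: b] starting with its minimum, the first entry of [b] must be
    positive, so the free sign of [m] can be stored on it; when [b] is empty, the
    sign of [m] tells a labelled leaf from a node with two empty leaves. *)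

(* [descent] says that the entry of absolute value [x] before [s] is smaller
   than its own predecessor. *)
Fixpoint signs_ok (descent : bool) (x : nat) (s : seq int) : bool :=
  if s is y :: s' then
    ((y < 0)%R ==> descent && (x < `|y|)) && signs_ok (`|y| < x) `|y| s'
  else true.

Definition valley_signed (s : seq int) : bool :=
  if s is y :: s' then (0 <= y)%R && signs_ok true `|y| s' else true.

Definition free_signed (s : seq int) : bool :=
  if s is y :: s' then signs_ok false `|y| s' else true.

Definition signed (b : bool) (x : nat) : int :=
  if b then (- Posz x)%R else Posz x.
Arguments signed : simpl never.

Definition neg_head (s : seq int) : bool :=
  if s is y :: _ then (y < 0)%R else false.

Definition abs_head (s : seq int) : seq int :=
  if s is y :: s' then (`|y|%N : int) :: s' else [::].

(** Matching on [free_word r] detects exactly the empty leaf ([free_word_nil]): labelled leaves and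
    nodes have nonempty words. *)
Fixpoint free_word (t : tree) : seq int :=
  match t with
  | Leaf None => [::]
  | Leaf (Some x) => [:: signed true x]
  | Node x l r =>
      if free_word r is [::] then
        signed (neg_head (free_word l)) x :: abs_head (free_word l)
      else free_word r ++ (x : int) :: free_word l
  end.

(** The value on a labelled leaf is junk: [word] is meant for trees satisfying [ends_empty]. *)
Fixpoint word (t : tree) : seq int :=
  if t is Node x l r then word r ++ (x : int) :: free_word l else [::].

Definition ends_empty (t : tree) : Prop := last None (rightmost_path t) = None.

(** * Signs, absolute values and labels *)

Lemma abs_signed b x : `|signed b x|%N = x.
Proof. by case: b; rewrite /signed; lia. Qed.

Lemma signed_abs (m : int) : signed (m < 0)%R `|m| = m.
Proof. by rewrite /signed; case: ifP => ?; lia. Qed.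

Lemma abs_window_cat s1 s2 :
  abs_window (s1 ++ s2) = abs_window s1 ++ abs_window s2.
Proof. exact: map_cat. Qed.

Lemma abs_window_abs_head s : abs_window (abs_head s) = abs_window s.
Proof. by case: s => //= y s; rewrite /abs_window /= absz_nat. Qed.

Lemma abs_head_inj s1 s2 :
  neg_head s1 = neg_head s2 -> abs_head s1 = abs_head s2 -> s1 = s2.
Proof.
case: s1 s2 => [|y1 s1] [|y2 s2] //= h [h1 ->].
by rewrite -(signed_abs y1) -(signed_abs y2) h h1.
Qed.

Lemma ends_empty_node x l r : ends_empty (Node x l r) <-> ends_empty r.
Proof. by rewrite /ends_empty /=; case: r => [[y|]|]. Qed.

Lemma perm_node_word x l r (a b : seq int) (m : int) :
  `|m|%N = x -> perm_eq (abs_window a) (labels r) ->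
  perm_eq (abs_window b) (labels l) ->
  perm_eq (abs_window (a ++ m :: b)) (labels (Node x l r)).
Proof.
move=> mx ha hb; rewrite abs_window_cat /= mx.
by rewrite perm_catC /= perm_cons perm_cat.
Qed.

Lemma perm_free_word t : perm_eq (abs_window (free_word t)) (labels t).
Proof.
elim: t => [[x|]|x l IHl r IHr] //.
  by rewrite /= abs_signed.
rewrite [free_word _]/=; case E: (free_word r) => [|y a]; last first.
  by rewrite -E; exact: perm_node_word.
apply: (@perm_node_word x l r [::]); rewrite ?abs_signed ?abs_window_abs_head //.
by rewrite -E.
Qed.

Lemma perm_word t : ends_empty t -> perm_eq (abs_window (word t)) (labels t).
Proof.
elim: t => [[x|]|x l _ r IHr] //.
move=> /ends_empty_node hr; apply: perm_node_word => //; first exact: IHr.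
exact: perm_free_word.
Qed.

Lemma free_word_nil t : free_word t = [::] -> t = Leaf None.
Proof.
case: t => [[x|]|x l r] //=.
by case: (free_word r).
Qed.

(** * Sign conditions across a cut at the minimum *)

Lemma signs_ok_cat c x a (m : int) b :
  `|m| < x -> all (ltn `|m|) (abs_window a) -> all (ltn `|m|) (abs_window b) ->
  signs_ok c x (a ++ m :: b) = [&& signs_ok c x a, (0 <= m)%R & free_signed b].
Proof.
elim: a c x => [|y a IHa] c x mx /=; last first.
  by move=> /andP[my ha] hb; rewrite IHa // andbA.
(* Now [m] directly follows the larger [x]: it cannot be negative, and it is a descent. Hence the
   first entry of [b], being above [m], has a free sign and is itself no descent. *)
move=> _ hb; rewrite (ltnNge x) (ltnW mx) andbF implybF -leNgt mx.
congr (_ && _); case: b hb => [|y b] //= /andP[my _]; rewrite my implybT /=.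
by congr signs_ok; lia.
Qed.

(** When [a] is empty, the initial flag [true] acts on [m] as a larger predecessor would. *)
Lemma valley_signed_cat a (m : int) b :
  all (ltn `|m|) (abs_window a) -> all (ltn `|m|) (abs_window b) ->
  valley_signed (a ++ m :: b) =
    [&& valley_signed a, (0 <= m)%R & free_signed b].
Proof.
case: a => [|y a] /=; last first.
  by move=> /andP[my ha] hb; rewrite signs_ok_cat // andbA.
move=> _; case: b => [|y b] //= /andP[my _]; rewrite my implybT /=.
by congr (_ && signs_ok _ _ _); lia.
Qed.

(** With [a] empty this would fail: a free word may start with a negative entry, and its first
    position is never a valley. *)
Lemma free_signed_cat a (m : int) b : a != [::] ->
  all (ltn `|m|) (abs_window a) -> all (ltn `|m|) (abs_window b) ->
  free_signed (a ++ m :: b) = [&& free_signed a, (0 <= m)%R & free_signed b].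
Proof.
by case: a => [|y a] //= _ /andP[my ha] hb; rewrite signs_ok_cat.
Qed.

(** A leading minimum of a free word is not a valley, so it forbids a negative entry just after it;
    its own sign is unconstrained. *)
Lemma free_signed_cons (m : int) b : all (ltn `|m|) (abs_window b) ->
  free_signed (m :: b) = ~~ neg_head b && free_signed b.
Proof.
case: b => [|y b] //= /andP[my _]; rewrite implybF.
by congr (_ && signs_ok _ _ _); lia.
Qed.

Lemma free_signed_abs_head b : free_signed (abs_head b) = free_signed b.
Proof. by case: b => //= y b; rewrite absz_nat. Qed.

Lemma neg_head_abs_head b : neg_head (abs_head b) = false.
Proof. by case: b. Qed.

Lemma free_signed_free_word t : increasing t -> free_signed (free_word t).
Proof.
elim: t => [[x|]|x l IHl r IHr] //= /and4P[hl hr /IHl fl /IHr fr].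
rewrite -!(perm_all _ (perm_free_word _)) in hl hr.
case E: (free_word r) => [|y a].
  rewrite free_signed_cons ?abs_signed ?abs_window_abs_head //.
  by rewrite neg_head_abs_head free_signed_abs_head.
by rewrite -E free_signed_cat ?absz_nat ?fr // E.
Qed.

Lemma valley_signed_word t :
  ends_empty t -> increasing t -> valley_signed (word t).
Proof.
elim: t => [[x|]|x l _ r IHr] //=.
move=> /ends_empty_node er /and4P[hl hr il ir].
rewrite -(perm_all _ (perm_free_word _)) in hl.
rewrite -(perm_all _ (perm_word er)) in hr.
by rewrite valley_signed_cat ?absz_nat // IHr // free_signed_free_word.
Qed.

(** * Injectivity: the word determines the tree *)

Lemma cat_min_inj (a a' b b' : seq int) (m m' : int) :
  a ++ m :: b = a' ++ m' :: b' ->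
  all (ltn `|m|) (abs_window a) -> all (ltn `|m|) (abs_window b) ->
  all (ltn `|m'|) (abs_window a') -> all (ltn `|m'|) (abs_window b') ->
  [/\ a = a', m = m' & b = b'].
Proof.
elim: a a' => [|z a IHa] [|z' a'] /=.
- by case=> -> ->.
(* Cuts at different places would make each of [m] and [m'] smaller in absolute value than the
   other. *)
- move=> [-> ->] _ hb /andP[lt1 _] _.
  move: hb; rewrite abs_window_cat all_cat /= => /and3P[_ lt2 _].
  by have := ltn_trans lt1 lt2; rewrite ltnn.
- move=> [<- <-] /andP[lt1 _] _ _.
  rewrite abs_window_cat all_cat /= => /and3P[_ lt2 _].
  by have := ltn_trans lt1 lt2; rewrite ltnn.
move=> [<- h] /andP[_ ha] hb /andP[_ ha'] hb'.
by have [-> -> ->] := IHa _ h ha hb ha' hb'.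
Qed.

(** Labels must be positive for signs to be visible: a leaf labelled 0 and a node labelled 0 with
    two empty leaves have the same word. *)
Lemma free_word_inj t t' : increasing t -> increasing t' ->
  all (ltn 0) (labels t) -> all (ltn 0) (labels t') ->
  free_word t = free_word t' -> t = t'.
Proof.
(* Cutting at the minimum treats uniformly the shapes distinguished by
   [free_word]. *)
pose cut t := match t with
  | Leaf None => None
  | Leaf (Some x) => Some ([::], signed true x, [::])
  | Node x l r => Some (if free_word r is [::] then
        ([::], signed (neg_head (free_word l)) x, abs_head (free_word l))
      else (free_word r, x : int, free_word l)) end.
have cut_inj u u' : increasing u -> increasing u' ->
    free_word u = free_word u' -> cut u = cut u'.
  have cutP v : increasing v ->
      if cut v is Some (a, m, b) then
        [/\ free_word v = a ++ m :: b, all (ltn `|m|) (abs_window a)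
          & all (ltn `|m|) (abs_window b)]
      else free_word v = [::].
    case: v => [[x|]|x l r] //= /and4P[hl hr _ _].
    rewrite -!(perm_all _ (perm_free_word _)) in hl hr.
    case E: (free_word r) => [|y a].
      by rewrite abs_signed abs_window_abs_head.
    by rewrite -E absz_nat.
  move=> /cutP + /cutP +.
  case: (cut u) (cut u') => [[[a m] b]|] [[[a' m'] b']|] //.
  - move=> [-> ha hb] [-> ha' hb'] h.
    by have [-> -> ->] := cat_min_inj h ha hb ha' hb'.
  - by move=> [-> _ _] ->; case: a.
  - by move=> -> [-> _ _]; case: a'.
elim: t t' => [o|x l IHl r IHr] t' inc inc' pos pos' /(cut_inj _ _ inc inc').
  case: o t' pos pos' {inc inc'} => [x|] [[x'|]|x' l' r'] //=.
    by rewrite /signed => _ _ [] h; congr (Leaf (Some _)); lia.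
  move=> /andP[x0 _] /andP[x0' _]; case: (free_word r') => //.
  by case: (free_word l') => [|y b] //= []; rewrite /signed; lia.
case: t' inc' pos' => [[x'|]|x' l' r'] //.
  move=> _ /= /andP[x0' _]; case: (free_word r) => //.
  by case: (free_word l) => [|y b] //= []; rewrite /signed; lia.
rewrite /= !all_cat in inc pos * => inc' pos'.
move: inc pos inc' pos' => /and4P[_ _ il ir] /and3P[x0 pl pr].
move=> /and4P[_ _ il' ir'] /and3P[x0' pl' pr'] [].
case E: (free_word r) => [|y a]; case E': (free_word r') => [|y' a'] //.
  move=> [hm hb].
  have xx' : x = x'.
    by rewrite -[LHS](abs_signed (neg_head (free_word l))) hm abs_signed.
  have ss' : neg_head (free_word l) = neg_head (free_word l').
    by move: hm; rewrite /signed; do 2!case: neg_head => //; lia.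
  have rr' := IHr _ ir ir' pr pr' (etrans E (esym E')).
  by rewrite xx' rr' (IHl _ il il' pl pl' (abs_head_inj ss' hb)).
rewrite -E -E' => -[fr xx' fl].
by rewrite xx' (IHr _ ir ir' pr pr' fr) (IHl _ il il' pl pl' fl).
Qed.

Lemma word_inj t t' : ends_empty t -> ends_empty t' ->
  increasing t -> increasing t' ->
  all (ltn 0) (labels t) -> all (ltn 0) (labels t') ->
  word t = word t' -> t = t'.
Proof.
elim: t t' => [[x|]|x l _ r IHr] [[x'|]|x' l' r'] //.
- by move=> _ _ _ _ _ _ /=; case: (word r').
- by move=> _ _ _ _ _ _ /=; case: (word r).
move=> /ends_empty_node er /ends_empty_node er'.
move=> /and4P[hl hr il ir] /and4P[hl' hr' il' ir'].
rewrite /= !all_cat => /and3P[_ pl pr] /and3P[_ pl' pr'] h.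
rewrite -(perm_all _ (perm_free_word l)) in hl.
rewrite -(perm_all _ (perm_free_word l')) in hl'.
rewrite -(perm_all _ (perm_word er)) in hr.
rewrite -(perm_all _ (perm_word er')) in hr'.
have [/(IHr _ er er' ir ir' pr pr') -> [->]] := cat_min_inj h hr hl hr' hl'.
by move=> /(free_word_inj il il' pl pl') ->.
Qed.

(** * Surjectivity: rebuilding the tree from its word *)

Lemma cut_at_min (s : seq int) : s != [::] -> uniq (abs_window s) ->
  exists a m b, [/\ s = a ++ m :: b, all (ltn `|m|) (abs_window a)
    & all (ltn `|m|) (abs_window b)].
Proof.
elim: s => // y s IHs _ /= /andP[ys us].
have [->|s0] := eqVneq s [::]; first by exists [::], y, [::].
have [a [m [b [sE ha hb]]]] := IHs s0 us.
move: ys; rewrite -/(abs_window s) sE abs_window_cat mem_cat inE !negb_or.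
move=> /and3P[_ ym _]; case: (ltngtP `|y| `|m|) ym => // lt _.
  exists [::], y, (a ++ m :: b); split=> //.
  rewrite abs_window_cat all_cat /= lt /=.
  by apply/andP; split; [move: ha|move: hb]; apply: sub_all => z; apply: ltn_trans.
by exists (y :: a), m, b; rewrite /= lt.
Qed.

Lemma abs_window_cut_uniq a (m : int) b : uniq (abs_window (a ++ m :: b)) ->
  uniq (abs_window a) /\ uniq (abs_window b).
Proof. by rewrite abs_window_cat cat_uniq /= => /and4P[-> _ _ ->]. Qed.

(** The induction is on length because, when the minimum comes first, the left subtree is recovered
    from [b'], which need not be a subword of [s]. *)
Lemma free_word_surj s : uniq (abs_window s) -> free_signed s ->
  exists2 t, increasing t & free_word t = s.
Proof.
have [n] := ubnP (size s); elim: n s => // n IHn s sn us fs.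
have [->|s0] := eqVneq s [::]; first by exists (Leaf None).
have [a [m [b [sE ha hb]]]] := cut_at_min s0 us.
move: sn us fs; rewrite sE size_cat /= => sn /abs_window_cut_uniq[ua ub].
have [a0|a0] := eqVneq a [::]; last first.
  rewrite free_signed_cat // => /and3P[fa m0 fb].
  have [|r ir ra] := IHn a _ ua fa; first lia.
  have [|l il lb] := IHn b _ ub fb; first lia.
  exists (Node `|m| l r); last first.
    by rewrite /= ra lb gez0_abs //; case: (a) a0.
  by rewrite /= -!(perm_all _ (perm_free_word _)) ra lb ha hb il ir.
rewrite {}a0 /= in sn ha * => fs.
(* Gives the sign of [m] back to the first entry of [b]. That entry is nonnegative by [fs], so
   [abs_head] undoes this. *)
pose b' := if b is y :: b1 then signed (m < 0)%R `|y| :: b1 else [::].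
have absb' : abs_window b' = abs_window b.
  by rewrite /b'; case: (b) => //= y b1; rewrite abs_signed.
have headb' : abs_head b' = b.
  move: fs; rewrite /b'; case: (b) => //= y b1 /andP[y0 _].
  by rewrite abs_signed; congr cons; lia.
have fb' : free_signed b'.
  move: fs; rewrite -[signs_ok _ _ _]/(free_signed (m :: b)) free_signed_cons //.
  by rewrite -[in free_signed b]headb' free_signed_abs_head => /andP[].
have [b0|b0] := eqVneq b [::].
  rewrite b0; case: (boolP (m < 0)%R) => m0.
    by exists (Leaf (Some `|m|%N)) => //=; congr [:: _]; rewrite /signed; lia.
  exists (Node `|m| (Leaf None) (Leaf None)) => //=.
    by congr [:: _]; rewrite /signed; lia.
have [||l il lb'] := IHn b' _ _ fb'.
- by rewrite -(size_map absz) -/(abs_window b') absb' size_map; lia.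
- by rewrite absb'.
exists (Node `|m| l (Leaf None)).
  by rewrite /= -(perm_all _ (perm_free_word l)) lb' absb' hb il.
rewrite /= lb' headb'; congr cons; rewrite -[RHS]signed_abs; congr signed.
rewrite /b'; case: (b) b0 hb => //= y b1 _ /andP[my _].
by rewrite /signed; case: ifP; lia.
Qed.

Lemma word_surj s : uniq (abs_window s) -> valley_signed s ->
  exists t, [/\ ends_empty t, increasing t & word t = s].
Proof.
have [n] := ubnP (size s); elim: n s => // n IHn s sn us fs.
have [->|s0] := eqVneq s [::]; first by exists (Leaf None).
have [a [m [b [sE ha hb]]]] := cut_at_min s0 us.
move: sn us fs; rewrite sE size_cat /= => sn /abs_window_cut_uniq[ua ub].
rewrite valley_signed_cat // => /and3P[fa m0 fb].
have [|r [er ir ra]] := IHn a _ ua fa; first lia.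
have [l il lb] := free_word_surj ub fb.
exists (Node `|m| l r); split; first exact/ends_empty_node.
  rewrite /= -(perm_all _ (perm_free_word _)) -(perm_all _ (perm_word er)).
  by rewrite ra lb ha hb il ir.
by rewrite /= ra lb gez0_abs.
Qed.

(** * Rightmost labels and valleys, read on words *)

Lemma rightmost_label_node x l r : ends_empty r ->
  rightmost_label (Node x l r) =
    if word r is y :: _ then rightmost_label r else Some x.
Proof.
(* If [r] is the empty leaf, the path stops just below [x]; if [r] is a node, prepending [x] leaves
   the last two vertices of the path unchanged. *)
case: r => [[y|]|y l' r'] //= er; rewrite /rightmost_label /=.
case: (word r') => [|z s] /=; by case: r' {er} => [o|].
Qed.

Lemma rightmost_label_word t : ends_empty t -> t <> Leaf None ->
  omap Posz (rightmost_label t) = ohead (word t).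
Proof.
elim: t => [[x|]|x l _ r IHr] // /ends_empty_node er _.
rewrite rightmost_label_node //=; case E: (word r) => [|y s] //=.
by rewrite IHr ?E // => r0; rewrite r0 in E.
Qed.

(** Prepending [x] puts the predecessor of entry [i] of [s] at index [i]. The two inequalities make
    that predecessor a valley, with [c] replacing the left one when it is [x]. *)
Lemma signs_okP (c : bool) x (s : seq int) :
  reflect (forall i, i < size s -> (nth 0%R s i < 0)%R ->
    nth 0 (x :: abs_window s) i < nth 0 (x :: abs_window s) i.+1 /\
    (if i is j.+1 then
       nth 0 (x :: abs_window s) i < nth 0 (x :: abs_window s) j else c))
  (signs_ok c x s).
Proof.
elim: s c x => [|y s IHs] c x /=; first by apply: ReflectT.
apply: (iffP andP) => [[/implyP hy /IHs hs] [|[|i]] //=|h].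
- by move=> _ /hy /andP[-> ->].
- by move=> lt /(hs 0 lt)[].
- by move=> lt /(hs i.+1 lt).
split; first by apply/implyP => y0; have [] := h 0 isT y0; rewrite /= => -> ->.
apply/IHs => -[|i] lt si; first by have := h 1 lt si.
by have := h i.+2 lt si.
Qed.

Lemma valley_signedP (s : seq int) :
  (forall i, 1 <= i <= size s -> (entry 0%R s i < 0)%R ->
    2 <= i /\ valley (abs_window s) i.-1) <-> valley_signed s.
Proof.
case: s => [|y s] /=; first by split=> // _ [|].
split=> [h|/andP[y0 /signs_okP h] [|[|i]]] //.
- apply/andP; split.
    by rewrite leNgt; apply/negP => y0; case: (h 1 isT y0).
  (* Index [i] of [s] is position [i.+2] of [y :: s], counted from 1. *)
  apply/signs_okP => i lt si; have [_] := h i.+2 lt si.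
  by case: i {lt si} => [|i] [[]|[]].
- by rewrite /entry /= ltNge y0.
- rewrite /= ltnS => lt si; split=> //; have [h1 h2] := h i lt si.
  (* For [i = 0] the valley is position 1, the second clause of [valley]. *)
  case: i lt h1 h2 {si} => [|i] lt h1 h2; [right|left]; split=> //=.
  all: by rewrite size_map.
Qed.

Lemma VSB_word n (s : n.-tuple int) : VSB n s <->
  perm_eq (abs_window s) (iota 1 n) /\ valley_signed s.
Proof.
rewrite /VSB /signed_perm /=; rewrite -valley_signedP size_tuple.
by [].
Qed.

Theorem theorem6p2 (n : nat) (hn : 1 <= n) :
  exists phi : n.-tuple int -> tree,
    set_bij (VSB n) (Tcirc n) phi /\
    forall k : nat, 1 <= k <= n ->
      set_bij (VSBk n k) (Tcirck n k) phi.
Proof.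
(* [phi] will be chosen as an inverse of [word], with [Leaf None] as a witness outside [VSB n]. *)
have tree_of s : exists t, VSB n s -> Tcirc n t /\ word t = s.
  have [/[dup] hs /VSB_word[ps vs]|] := pselect (VSB n s); last first.
    by exists (Leaf None).
  have us : uniq (abs_window s) by rewrite (perm_uniq ps) iota_uniq.
  have [t [et it ts]] := word_surj us vs; exists t => _.
  split=> //; split=> //; split=> //.
  by apply: perm_trans ps; rewrite -ts perm_sym perm_word.
have [phi phiP] := choice tree_of.
have pos t : Tcirc n t -> all (ltn 0) (labels t).
  move=> [[pt _] _]; rewrite (perm_all _ pt); apply/allP => x.
  by rewrite mem_iota => /andP[].
have phi_surj t : Tcirc n t -> exists s, [/\ VSB n s, phi s = t & word t = s].
  move=> /[dup] ht [[pt it] et].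
  have pw : perm_eq (abs_window (word t)) (iota 1 n).
    by apply: perm_trans pt; apply: perm_word.
  have sz : size (word t) == n.
    by rewrite -(size_map absz) (perm_size pw) size_iota.
  have hs : VSB n (Tuple sz) by apply/VSB_word; split=> //; exact: valley_signed_word.
  exists (Tuple sz); split=> //.
  have [[[pt' it'] et'] /= wE] := phiP _ hs.
  by apply: word_inj => //; apply: pos.
have phi_inj s s' : VSB n s -> VSB n s' -> phi s = phi s' -> s = s'.
  by move=> /phiP[_ h] /phiP[_ h'] e; apply: val_inj; rewrite /= -h -h' e.
have label_phi t k (s : n.-tuple int) : Tcirc n t -> word t = s ->
    rightmost_label t = Some k <-> entry 0%R s 1 = Posz k.
  move=> [_ et] ts.
  (* As [n] is positive, [t] is not a bare leaf and [entry] does not fall back on its default. *)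
  have s0 : word t <> [::].
    by move=> w0; move: hn; rewrite -(size_tuple s) -ts w0.
  have /rightmost_label_word : t <> Leaf None by move=> t0; rewrite t0 in s0.
  move=> /(_ et); rewrite /entry /= -ts.
  case: (word t) s0 => // y w _ /=; case: rightmost_label => //= j [<-].
  by split=> [[->]|[->]].
exists phi; split=> [|k _].
  split; first by move=> s /phiP[].
    by move=> s s'; rewrite !inE => hs hs'; exact: phi_inj.
  by move=> t /phi_surj[s [hs st _]]; exists s.
split.
- move=> s [/phiP[ht ts] sk]; split=> //.
  exact/(label_phi _ _ _ ht ts).
- by move=> s s'; rewrite !inE => -[hs _] [hs' _]; exact: phi_inj.
- move=> t [ht tk]; have [s [hs st ts]] := phi_surj _ ht.
  by exists s => //; split=> //; apply/(label_phi _ _ _ ht ts).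
Qed.
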